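(* Let $F$ be a field of characteristic $0$, and let $r(x)$ and $s(x)$ be proper rational functions over $F$ with the same denominator $D(x)=1+Ax+Bx^2+Cx^3$, where $A,B,C\in F$ and $C\ne0$. Suppose that $D(x)=(1-\alpha_1x)(1-\alpha_2x)(1-\alpha_3x)$, with $\alpha_1,\alpha_2,\alpha_3$ in an extension field of $F$, where $2\alpha_i\ne\alpha_j+\alpha_k$ for all $i,j,k\in\{1,2,3\}$ not all equal. Then for some polynomials $u(x)$ and $v(x)$ of degree at most $2$, $$r(x)\odot s(x)=\frac{u(x)}{D(2x)}+\frac{1}{1+Ax}\odot\frac{v(x)}{D(-x)}.$$
   Context: For formal power series with coefficients in a field of characteristic $0$, the binomial product $\odot$ is defined by $\sum_{n\ge0}a_nx^n\odot\sum_{n\ge0}b_nx^n=\sum_{n\ge0}c_nx^n$, where $c_n=\sum_{k=0}^n\binom nk a_kb_{n-k}$; rational functions whose denominators have nonzero constant term are identified with their power series expansions. A rational function is proper if the degree of its numerator is less than the degree of its denominator; here $r(x)$ and $s(x)$ are of the form $p(x)/D(x)$ with $\deg p\le2$ (not necessarily in lowest terms). *)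

(* Defs.v *)
From HB Require Import structures.
From mathcomp Require Import all_boot all_order all_algebra.
Set Implicit Arguments.
Unset Strict Implicit.
Unset Printing Implicit Defensive.
Import GRing.Theory.
Local Open Scope ring_scope.

(* A formal power series is its coefficient sequence [nat -> F]: sums are     *)
(* written [f \+ g] and equality is equality of all coefficients, [f =1 g].   *)

Notation "p %:F" := (FracField.tofrac p) : ring_scope.

Definition binomial_product (F : fieldType) (a b : nat -> F) : nat -> F :=
  fun n => \sum_(k < n.+1) 'C(n, k)%:R * a k * b (n - k)%N.

Notation "a \odot b" := (binomial_product a b)
  (at level 40, left associativity) : ring_scope.

(* The first n coefficients of the power series f with q * f = p, obtained by *)
(* long division; meaningful when q`_0 != 0.                                  *)
Fixpoint quotient_coefs (F : fieldType) (p q : {poly F}) (n : nat) : seq F :=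
  if n is m.+1 then
    let s := quotient_coefs p q m in
    rcons s ((p`_m - \sum_(k < m) q`_(m - k) * s`_k) / q`_0)
  else [::].

Definition poly_quotient_series (F : fieldType) (p q : {poly F}) : nat -> F :=
  fun n => (quotient_coefs p q n.+1)`_n.

Lemma repr_denominator (R : idomainType) (r : {fraction R}) :
  r * (\d_(repr r))%:F = (\n_(repr r))%:F.
Proof.
transitivity (\pi_({fraction R})%qT (repr r) * (\d_(repr r))%:F).
  by rewrite reprK.
move: (repr r) => x; rewrite -[_ * _]/(FracField.mul _ _) !piE.
apply/eqmodP; rewrite /= FracField.equivfE /FracField.mulf.
rewrite !numden_Ratio ?mulf_neq0 ?oner_eq0 ?denom_ratioP //.
by rewrite !mulr1 mulrC.
Qed.

Lemma fraction_cross (R : idomainType) (n d p q : R) : d != 0 -> q != 0 ->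
  n%:F / d%:F = p%:F / q%:F -> p * d = n * q.
Proof.
move=> d0 q0 /eqP; rewrite eqr_div ?tofrac_eq0 // -!tofracM tofrac_eq.
by move/eqP.
Qed.

Section Fractions.

Variable F : fieldType.
Implicit Types (p q : {poly F}) (r : {fraction {poly F}}).

(* [repr r] is an arbitrary representative, so its common factors have to be  *)
(* removed: only the reduced denominator shows whether r has an expansion.    *)
Definition numerator r : {poly F} :=
  \n_(repr r) %/ gcdp \n_(repr r) \d_(repr r).

Definition denominator r : {poly F} :=
  \d_(repr r) %/ gcdp \n_(repr r) \d_(repr r).

(* Power series expansion of a rational function, a junk value if the reduced *)
(* denominator vanishes at 0. If r = p / q with q(0) != 0, it is the only      *)
(* series f with q * f = p: see [expansionP] and [expansion_unique].           *)
Definition expansion r : nat -> F :=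
  poly_quotient_series (numerator r) (denominator r).

Definition proper_with_denominator (D : {poly F}) r : Prop :=
  exists2 p : {poly F}, (size p < size D)%N & r = p%:F / D%:F.

Lemma size_quotient_coefs p q n : size (quotient_coefs p q n) = n.
Proof. by elim: n => //= n IHn; rewrite size_rcons IHn. Qed.

Lemma nth_quotient_coefs p q n k : (k < n)%N ->
  (quotient_coefs p q n)`_k = poly_quotient_series p q k.
Proof.
elim: n => // n IHn; rewrite ltnS leq_eqVlt => /orP[/eqP-> //|ltkn].
by rewrite /= nth_rcons size_quotient_coefs ltkn IHn.
Qed.

Lemma poly_quotient_seriesP p q n : q`_0 != 0 ->
  \sum_(k < n.+1) q`_(n - k) * poly_quotient_series p q k = p`_n.
Proof.
move=> q0; rewrite big_ord_recr /= subnn {2}/poly_quotient_series /=.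
rewrite nth_rcons size_quotient_coefs ltnn eqxx mulrC divfK //.
rewrite [X in _ + (_ - X)](eq_bigr
  (fun k : 'I_n => q`_(n - k) * poly_quotient_series p q k)).
  by rewrite addrC subrK.
by move=> k _; rewrite nth_quotient_coefs.
Qed.

Lemma poly_quotient_series_unique p q (f : nat -> F) : q`_0 != 0 ->
  (forall n, \sum_(k < n.+1) q`_(n - k) * f k = p`_n) ->
  f =1 poly_quotient_series p q.
Proof.
move=> q0 fP n; elim/ltn_ind: n => n IHn.
have := etrans (fP n) (esym (poly_quotient_seriesP p n q0)).
rewrite !big_ord_recr /= subnn (eq_bigr
  (fun k : 'I_n => q`_(n - k) * poly_quotient_series p q k)).
  by move/addrI/(mulfI q0).
by move=> k _; rewrite IHn.
Qed.

Lemma numerator_denominator r p q : q != 0 -> r = p%:F / q%:F ->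
  exists2 m, q = m * denominator r & p = m * numerator r.
Proof.
move=> q0 rE; set n := \n_(repr r); set d := \d_(repr r).
have d0 : d != 0 by apply: denom_ratioP.
have rE' : r = n%:F / d%:F.
  have dF0 : d%:F != 0 by rewrite tofrac_eq0.
  by apply: (mulIf dF0); rewrite divfK // repr_denominator.
have cross : p * d = n * q.
  exact: fraction_cross (etrans (esym rE') rE).
have g0 : gcdp n d != 0 by rewrite gcdp_eq0 negb_and d0 orbT.
have nE : n = numerator r * gcdp n d by rewrite divpK ?dvdp_gcdl.
have dE : d = denominator r * gcdp n d by rewrite divpK ?dvdp_gcdr.
have cross' : p * denominator r = numerator r * q.
  by apply: (mulIf g0); rewrite -mulrA -dE mulrAC -nE.
have den0 : denominator r != 0.
  by apply: contraNneq d0 => e; rewrite dE e mul0r.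
have cop : coprimep (denominator r) (numerator r).
  by rewrite coprimep_sym coprimep_div_gcd // d0 orbT.
have dvq : denominator r %| q.
  by rewrite -(Gauss_dvdpr _ cop) -cross' dvdp_mull.
exists (q %/ denominator r); first by rewrite divpK.
by apply: (mulIf den0); rewrite cross' mulrAC divpK // mulrC.
Qed.

Lemma coefM_truncated q (f : nat -> F) N n : (n < N)%N ->
  (q * \poly_(i < N) f i)`_n = \sum_(k < n.+1) q`_(n - k) * f k.
Proof.
move=> ltnN; rewrite coefMr; apply: eq_bigr => k _.
by rewrite coef_poly (leq_ltn_trans _ ltnN) // -ltnS.
Qed.

Lemma expansionE r p q : q`_0 != 0 -> r = p%:F / q%:F ->
  expansion r =1 poly_quotient_series p q.
Proof.
move=> q0 rE.
have qn0 : q != 0 by apply: contraNneq q0 => ->; rewrite coef0.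
have [m qE pE] := numerator_denominator qn0 rE.
have den0 : (denominator r)`_0 != 0.
  by move: q0; rewrite qE coef0M mulf_eq0 negb_or => /andP[].
apply: poly_quotient_series_unique => // n.
rewrite -(coefM_truncated _ _ (ltnSn n)) qE -mulrA pE !coefM.
apply: eq_bigr => k _; congr (_ * _).
by rewrite coefM_truncated ?poly_quotient_seriesP // ltnS leq_subr.
Qed.

Lemma expansionP r p q n : q`_0 != 0 -> r = p%:F / q%:F ->
  \sum_(k < n.+1) q`_(n - k) * expansion r k = p`_n.
Proof.
move=> q0 rE; under eq_bigr do rewrite (expansionE q0 rE).
exact: poly_quotient_seriesP.
Qed.

Lemma expansion_unique r p q (f : nat -> F) : q`_0 != 0 ->
  r = p%:F / q%:F ->
  (forall n, \sum_(k < n.+1) q`_(n - k) * f k = p`_n) -> f =1 expansion r.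
Proof.
move=> q0 rE fP n; rewrite (expansionE q0 rE).
exact: poly_quotient_series_unique.
Qed.

End Fractions.

(* Main.v *)
Require Import Defs.
From HB Require Import structures.
From mathcomp Require Import all_boot all_order all_algebra.
From mathcomp Require Import ring.
From Stdlib Require Import Classical_Prop.
Set Implicit Arguments.
Unset Strict Implicit.
Unset Printing Implicit Defensive.
Import GRing.Theory.
Local Open Scope ring_scope.

(** Over [L] the identity is partial fractions. The [alpha i] are distinct
(genericity with two equal indices) and nonzero ([C != 0]), so the expansions
of [r] and [s] become [\sum_i a i * alpha i ^+ n] and
[\sum_j b j * alpha j ^+ n] ([expansion_exponential_sum]). The binomial theorem
says that the binomial product of the geometric series of ratios x and y is the
geometric series of ratio x + y, so the product has coefficients
[\sum_i \sum_j a i * b j * (alpha i + alpha j) ^+ n]. The diagonal terms have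
the ratios [2 * alpha i], the reciprocal roots of D(2x). For distinct i, j with
third index k, [alpha i + alpha j = - A - alpha k], because the [alpha i] add up
to [- A]; since [- alpha k] are the reciprocal roots of D(-x), these terms are
the binomial product of 1/(1 + A x) with an exponential sum of denominator D(-x)
([power_sum_pairs]).

This gives numerators u and v with coefficients in [L], and they have to be
found in [F]. The right-hand side depends linearly on (u, v): it is a linear
combination of six fixed sequences in [F], obtained from the numerators 1, x,
x^2. So what is proved over [L] is that a sequence in [F] lies in the span of
six sequences in [F], and such a relation already holds over [F], by Gaussian
elimination ([span_descent]). *)

(** * Descent of linear relations along a field extension *)

(** A linear system over [F], here with one equation for each [t : T], that is
solvable over [L] is solvable over [F]. The set of equations may be infinite;
the induction is on the number [m] of unknowns, each step eliminating the first
one by means of an equation in which its coefficient is nonzero. *)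
Lemma span_descent (F L : fieldType) (iota : {rmorphism F -> L}) (T : Type)
    (m : nat) (g : 'I_m -> T -> F) (f : T -> F) (c : 'I_m -> L) :
    (forall t, iota (f t) = \sum_(i < m) c i * iota (g i t)) ->
  exists d : 'I_m -> F, forall t, f t = \sum_(i < m) d i * g i t.
Proof.
elim: m g f c => [|m IHm] g f c fE.
  exists (fun=> 0) => t; apply: (fmorph_inj iota).
  by rewrite fE !big_ord0 rmorph0.
have [[t0 gt0]|g0] := classic (exists t, g ord0 t != 0); last first.
  have {}g0 t : g ord0 t = 0.
    by apply/eqP; apply: NNPP => /negP gt; case: g0; exists t.
  have [|d dE] := IHm (fun i => g (lift ord0 i)) f (fun i => c (lift ord0 i)).
    by move=> t; rewrite fE big_ord_recl g0 rmorph0 mulr0 add0r.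
  exists (fun i => oapp d 0 (unlift ord0 i)) => t.
  rewrite dE big_ord_recl g0 mulr0 add0r.
  by apply: eq_bigr => i _; rewrite liftK.
(* Row reduction with pivot [t0]: kills [g ord0] and the equation at [t0]. *)
pose elim_g0 (h : T -> F) t := h t - h t0 / g ord0 t0 * g ord0 t.
have [|d dE] := IHm (fun i => elim_g0 (g (lift ord0 i))) (elim_g0 f)
  (fun i => c (lift ord0 i)).
  move=> t; rewrite /elim_g0 rmorphB !rmorphM fmorphV !fE !big_ord_recl.
  have gt0' : iota (g ord0 t0) != 0 by rewrite fmorph_eq0.
  under [RHS]eq_bigr do
    rewrite rmorphB !rmorphM fmorphV mulrBr !mulrA.
  rewrite sumrB -!mulr_suml; by field.
exists (fun i => if unlift ord0 i is Some j then d j else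
   (f t0 - \sum_j d j * g (lift ord0 j) t0) / g ord0 t0) => t.
rewrite big_ord_recl unlift_none.
have := dE t; rewrite /elim_g0.
under eq_bigr do rewrite mulrBr !mulrA.
rewrite sumrB -!mulr_suml => /eqP; rewrite subr_eq => /eqP ->.
under [X in _ = _ + X]eq_bigr do rewrite liftK.
by field.
Qed.

(** * Power series quotients *)

(** The equation q * f = p, coefficient by coefficient. Stating it as a relation
makes it linear in (p, f) and stable under field morphisms, which a division
algorithm does not show. *)
Definition is_quotient (F : fieldType) (p q : {poly F}) (f : nat -> F) : Prop :=
  forall n, \sum_(k < n.+1) q`_(n - k) * f k = p`_n.

Section Quotients.

Variable F : fieldType.
Implicit Types (p q : {poly F}) (f g : nat -> F).

Lemma is_quotient_unique p q f g : q`_0 != 0 ->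
  is_quotient p q f -> is_quotient p q g -> f =1 g.
Proof.
move=> q0 fP gP n.
by rewrite (poly_quotient_series_unique q0 fP) (poly_quotient_series_unique q0 gP).
Qed.

Lemma is_quotient_expansion p q : q`_0 != 0 ->
  is_quotient p q (expansion (p%:F / q%:F)).
Proof. by move=> q0 n; apply: expansionP. Qed.

Lemma is_quotient_sum (I : finType) (c : I -> F) (P : I -> {poly F}) q
    (f : I -> nat -> F) : (forall i, is_quotient (P i) q (f i)) ->
  is_quotient (\sum_i c i *: P i) q (fun n => \sum_i c i * f i n).
Proof.
move=> fP n; under eq_bigr do rewrite mulr_sumr.
rewrite exchange_big coef_sum; apply: eq_bigr => i _.
rewrite coefZ -fP mulr_sumr; apply: eq_bigr => k _; exact: mulrCA.
Qed.

(** Since 1 / (1 - x X) = sum of x^n X^n, cancelling the factor [1 - x *: 'X]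
leaves the numerator [p]; the truncation of the series at degree n is enough for the
coefficient n. *)
Lemma is_quotient_geometric p (x : F) :
  is_quotient p ((1 - x *: 'X) * p) (fun n => x ^+ n).
Proof.
move=> n; rewrite -(coefM_truncated _ _ (ltnSn n)) mulrAC.
have -> : (1 - x *: 'X) * \poly_(i < n.+1) x ^+ i = 1 - (x *: 'X) ^+ n.+1.
  rewrite -[1 in RHS](expr1n _ n.+1) subrXX poly_def; congr (_ * _).
  by apply: eq_bigr => i _; rewrite expr1n mul1r exprZn.
rewrite mulrBl mul1r coefB exprZn -scalerAl coefZ coefXnM ltnSn mulr0.
exact: subr0.
Qed.

Lemma is_quotient_cofactor m (x : 'I_m -> F) (i : 'I_m) :
  is_quotient (\prod_(j < m | j != i) (1 - x j *: 'X))
    (\prod_(j < m) (1 - x j *: 'X)) (fun n => x i ^+ n).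
Proof.
rewrite [X in is_quotient _ X](bigD1 i) //=; exact: is_quotient_geometric.
Qed.

Lemma size_sumX m (c : 'I_m -> F) : (size (\sum_(j < m) c j *: 'X^j)%R <= m)%N.
Proof.
elim/big_ind: _ => [|p q sp sq|j _]; first by rewrite size_poly0.
  by rewrite (leq_trans (size_polyD _ _)) // geq_max sp.
by rewrite (leq_trans (size_scale_leq _ _)) // size_polyXn.
Qed.

Lemma expansion_sumX m (c : 'I_m -> F) q n : q`_0 != 0 ->
  expansion ((\sum_(j < m) c j *: 'X^j)%:F / q%:F) n =
  \sum_(j < m) c j * expansion (('X^j)%:F / q%:F) n.
Proof.
move=> q0; move: n; apply: (is_quotient_unique q0).
  exact: is_quotient_expansion.
by apply: is_quotient_sum => j; apply: is_quotient_expansion.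
Qed.

(** * Partial fractions *)

Lemma size_cofactor_combination m (x c : 'I_m -> F) :
  (size (\sum_(i < m) c i *: \prod_(j < m | j != i) (1 - x j *: 'X))%R <= m)%N.
Proof.
elim/big_ind: _ => [|p q sp sq|i _]; first by rewrite size_poly0.
  by rewrite (leq_trans (size_polyD _ _)) // geq_max sp.
apply: leq_trans (size_scale_leq _ _) _.
apply: leq_trans (size_prod_leq _ _) _.
have m0 : (0 < m)%N by apply: leq_ltn_trans (ltn_ord i).
have card : #|[pred j | j != i]| = m.-1.
  by rewrite -[m in RHS]card_ord -(cardC1 i).
have size2 j : (size (1 - x j *: 'X)%R <= 2)%N.
  rewrite (leq_trans (size_polyD _ _)) // geq_max size_poly1 size_polyN.
  by rewrite (leq_trans (size_scale_leq _ _)) ?size_polyX.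
rewrite leq_subLR card.
have le_sum : (\sum_(j < m | j != i) size (1 - x j *: 'X)%R <= m.-1 * 2)%N.
  by rewrite -card -sum_nat_const leq_sum.
apply: leq_ltn_trans le_sum _.
by rewrite muln2 -addnn -[m in X in (_ < X)%N](prednK m0) addnS.
Qed.

(** Lagrange interpolation: at the point [(x i)^-1] only the summand of index [i]
survives, so the values of [p] at these [m] distinct points determine the
coefficients, and a polynomial of size at most [m] is determined by them. *)
Lemma partial_fractions m (x : 'I_m -> F) p :
    injective x -> (forall i, x i != 0) -> (size p <= m)%N ->
  exists c : 'I_m -> F,
    p = \sum_(i < m) c i *: \prod_(j < m | j != i) (1 - x j *: 'X).
Proof.
move=> x_inj x0 pm.
pose P i := \prod_(j < m | j != i) (1 - x j *: 'X).
have P_root i k : k != i -> (P i).[(x k)^-1] = 0.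
  move=> ki; rewrite /P (bigD1 k) //= hornerM !hornerE.
  by rewrite mulfV // subrr mul0r.
have P_nroot i : (P i).[(x i)^-1] != 0.
  rewrite horner_prod; apply/prodf_neq0 => j ji; rewrite !hornerE subr_eq0.
  apply: contra ji => /eqP xE; apply/eqP/x_inj/(mulIf (invr_neq0 (x0 i))).
  by rewrite -xE mulfV.
exists (fun i => p.[(x i)^-1] / (P i).[(x i)^-1]).
rewrite -[RHS]/(\sum_(i < m) _ *: P i); apply/eqP; rewrite -subr_eq0; apply/eqP.
apply: (@roots_geq_poly_eq0 _ _ [seq (x i)^-1 | i <- enum 'I_m]).
- apply/allP => _ /mapP[i _ ->]; rewrite rootE hornerD hornerN horner_sum.
  rewrite (bigD1 i) //= big1 => [|k ki]; last first.
    by rewrite hornerZ (P_root k i) ?mulr0 1?eq_sym.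
  by rewrite hornerZ divfK // addr0 subrr.
- by rewrite map_inj_uniq ?enum_uniq // => i j /invr_inj/x_inj.
rewrite size_map size_enum_ord (leq_trans (size_polyD _ _)) // geq_max pm size_polyN.
exact: size_cofactor_combination.
Qed.

(** * The binomial product *)

Lemma binomial_product_geometric (x y : F) n :
  ((fun n => x ^+ n) \odot (fun n => y ^+ n)) n = (x + y) ^+ n.
Proof.
rewrite addrC exprDn; apply: eq_bigr => k _.
by rewrite -mulrA mulrC mulr_natr mulrC.
Qed.

Lemma binomial_product_suml (I : finType) (a : I -> F) (f : I -> nat -> F) g n :
  ((fun n => \sum_i a i * f i n) \odot g) n = \sum_i a i * (f i \odot g) n.
Proof.
rewrite /binomial_product; under eq_bigr do rewrite mulr_sumr mulr_suml.
rewrite exchange_big; apply: eq_bigr => i _; rewrite mulr_sumr.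
by apply: eq_bigr => k _; ring.
Qed.

Lemma binomial_product_sumr (I : finType) (a : I -> F) f (g : I -> nat -> F) n :
  (f \odot (fun n => \sum_i a i * g i n)) n = \sum_i a i * (f \odot g i) n.
Proof.
rewrite /binomial_product; under eq_bigr do rewrite mulr_sumr.
rewrite exchange_big; apply: eq_bigr => i _; rewrite mulr_sumr.
by apply: eq_bigr => k _; ring.
Qed.

Lemma eq_binomial_product (f f' g g' : nat -> F) :
  f =1 f' -> g =1 g' -> f \odot g =1 f' \odot g'.
Proof. by move=> ff gg n; apply: eq_bigr => k _; rewrite ff gg. Qed.

End Quotients.

(** * Exponential sums over a field extension *)

Section Extension.

Variables (F L : fieldType) (iota : {rmorphism F -> L}).

Lemma is_quotient_map (p q : {poly F}) f : is_quotient p q f ->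
  is_quotient (map_poly iota p) (map_poly iota q) (iota \o f).
Proof.
move=> fP n; rewrite coef_map -fP /= rmorph_sum; apply: eq_bigr => k _.
by rewrite coef_map rmorphM.
Qed.

Lemma map_binomial_product (f g : nat -> F) n :
  iota ((f \odot g) n) = ((iota \o f) \odot (iota \o g)) n.
Proof.
rewrite rmorph_sum; apply: eq_bigr => k _.
by rewrite !rmorphM rmorph_nat.
Qed.

Variables (m : nat) (q : {poly F}) (x : 'I_m -> L).
Hypothesis q_factor : map_poly iota q = \prod_(i < m) (1 - x i *: 'X).

Lemma split_denominator_neq0 : q`_0 != 0.
Proof.
have : (map_poly iota q)`_0 != 0.
  rewrite q_factor -horner_coef0 horner_prod; apply/prodf_neq0 => i _.
  by rewrite !hornerE subr0 oner_neq0.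
by rewrite coef_map fmorph_eq0.
Qed.

(** The expansion has coefficients in [F], but the roots of its denominator are
only available in [L]; partial fractions are taken there. *)
Lemma expansion_exponential_sum (p : {poly F}) :
    injective x -> (forall i, x i != 0) -> (size p <= m)%N ->
  exists c : 'I_m -> L, forall n,
    iota (expansion (p%:F / q%:F) n) = \sum_(i < m) c i * x i ^+ n.
Proof.
move=> x_inj x0 pm; have q0 := split_denominator_neq0.
have [|c cE] := partial_fractions (p := map_poly iota p) x_inj x0.
  by rewrite size_map_poly.
exists c; apply: (@is_quotient_unique _ (map_poly iota p) (map_poly iota q)).
- by rewrite coef_map fmorph_eq0.
- exact/is_quotient_map/is_quotient_expansion.
rewrite cE; apply: is_quotient_sum => i.
rewrite q_factor; exact: is_quotient_cofactor.
Qed.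

(** Converse to [expansion_exponential_sum]: an exponential sum is
a rational function with denominator [q], whose numerator has coefficients [d j]
in [L]. It is put in the form that [span_descent] takes, a combination over [L]
of sequences coming from [F]. *)
Lemma exponential_sum_in_span (c : 'I_m -> L) :
  exists d : 'I_m -> L, forall n, \sum_(i < m) c i * x i ^+ n =
    \sum_(j < m) d j * iota (expansion (('X^j)%:F / q%:F) n).
Proof.
have q0 := split_denominator_neq0.
pose P i := \prod_(j < m | j != i) (1 - x j *: 'X).
pose p := \sum_i c i *: P i.
have sp : (size p <= m)%N by exact: size_cofactor_combination.
exists (fun j => p`_j).
apply: (@is_quotient_unique _ p (map_poly iota q)).
- by rewrite coef_map fmorph_eq0.
- apply: is_quotient_sum => i.
  rewrite q_factor; exact: is_quotient_cofactor.
have pE : p = \sum_(j < m) p`_j *: 'X^j.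
  rewrite -poly_def; apply/polyP => j; rewrite coef_poly.
  by case: ltnP => // mj; rewrite nth_default // (leq_trans sp).
rewrite [X in is_quotient X]pE; apply: is_quotient_sum => j; rewrite -(map_polyXn iota).
exact/is_quotient_map/is_quotient_expansion.
Qed.

End Extension.

(** * The cubic case *)

Lemma scaled_factorization (F L : fieldType) (iota : {rmorphism F -> L})
    (m : nat) (q : {poly F}) (x : 'I_m -> L) (t : F) :
    map_poly iota q = \prod_(i < m) (1 - x i *: 'X) ->
  map_poly iota (q \Po (t *: 'X)) = \prod_(i < m) (1 - (iota t * x i) *: 'X).
Proof.
move=> qE; rewrite map_comp_poly qE map_polyZ map_polyX rmorph_prod.
apply: eq_bigr => i _ /=.
rewrite rmorphB rmorph1 /= comp_polyZ comp_polyX scalerA.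
by rewrite mulrC.
Qed.

Lemma expansion_geometric (F : fieldType) (a : F) n :
  expansion (1 / (1 + a *: 'X)%:F) n = (- a) ^+ n.
Proof.
have q0 : (1 + a *: 'X)`_0 != 0 :> F.
  by rewrite coefD coef1 coefZ coefX mulr0 addr0 oner_eq0.
move: n; apply: (is_quotient_unique (p := 1) q0).
  by rewrite -tofrac1; apply: is_quotient_expansion.
rewrite -[_ + _]mulr1 -[a in 1 + a *: _]opprK scaleNr.
exact: is_quotient_geometric.
Qed.

(** In [theorem12] the coefficient of degree 1 identifies [- A] as the sum of the
[alpha i], and that of degree 3 shows that none of them vanishes. *)
Lemma cubic_extreme_coefs (L : fieldType) (x : 'I_3 -> L) :
  exists e, \prod_(i < 3) (1 - x i *: 'X) =
    1 + (- \sum_i x i) *: 'X + e *: 'X^2 + (- \prod_i x i) *: 'X^3.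
Proof.
pose i0 : 'I_3 := ord0; pose i1 : 'I_3 := lift ord0 ord0.
pose i2 : 'I_3 := lift ord0 (lift ord0 ord0).
exists (x i0 * (x i1 + x i2) + x i1 * x i2).
rewrite !big_ord_recl !big_ord0 /= -!mul_polyC.
by rewrite !(rmorphD, rmorphN, rmorphM, rmorph0, rmorph1); ring.
Qed.

(** Two distinct indices in ['I_3] leave exactly one index [k] out, and then
[x i + x j] is the sum of all three minus [x k]. *)
Lemma power_sum_pairs (L : fieldType) (x a b : 'I_3 -> L) n :
  \sum_i a i * (\sum_j b j * (x i + x j) ^+ n) =
  \sum_i a i * b i * (2%:R * x i) ^+ n +
  \sum_k (\sum_i \sum_j if [&& i != j, i != k & j != k] then a i * b j else 0)
    * (\sum_i x i - x k) ^+ n.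
Proof.
pose i0 : 'I_3 := ord0; pose i1 : 'I_3 := lift ord0 ord0.
pose i2 : 'I_3 := lift ord0 (lift ord0 ord0).
rewrite !big_ord_recl !big_ord0 /= -/i0 -/i1 -/i2.
have -> : x i0 + (x i1 + (x i2 + 0)) - x i0 = x i1 + x i2 by ring.
have -> : x i0 + (x i1 + (x i2 + 0)) - x i1 = x i0 + x i2 by ring.
have -> : x i0 + (x i1 + (x i2 + 0)) - x i2 = x i0 + x i1 by ring.
(* [ring] does not look inside a power with a variable exponent, so the bases
have to agree syntactically. *)
rewrite !mulr_natl !mulr2n (addrC (x i1) (x i0)) (addrC (x i2)).
rewrite (addrC (x i2) (x i1)).
ring.
Qed.

Theorem theorem12 (F : fieldType) (charF : [pchar F] =i pred0)
    (A B C : F) (C_neq0 : C != 0)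
    (D : {poly F}) (DE : D = 1 + A *: 'X + B *: 'X^2 + C *: 'X^3)
    (r s : {fraction {poly F}})
    (r_proper : proper_with_denominator D r)
    (s_proper : proper_with_denominator D s)
    (L : fieldType) (iota : {rmorphism F -> L}) (alpha : 'I_3 -> L)
    (D_factor : map_poly iota D = \prod_(i < 3) (1 - alpha i *: 'X))
    (alpha_generic : forall i j k : 'I_3, ~ (i = j /\ j = k) ->
       2%:R * alpha i != alpha j + alpha k) :
  exists u v : {poly F}, (size u <= 3)%N /\ (size v <= 3)%N /\
    expansion r \odot expansion s =1
      expansion (u%:F / (D \Po (2%:R *: 'X))%:F)
      \+ expansion (1 / (1 + A *: 'X)%:F) \odot expansion (v%:F / (D \Po (- 'X))%:F).
Proof.
have alpha_inj : injective alpha.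
  move=> i j ij; apply/eqP; apply: contraT => /eqP i_neq_j.
  have := alpha_generic i i j (fun H => i_neq_j H.2).
  by rewrite ij mulr_natl mulr2n eqxx.
have DE' : map_poly iota D = 1 + iota A *: 'X + iota B *: 'X^2 + iota C *: 'X^3.
  by rewrite DE !rmorphD rmorph1 /= !map_polyZ !map_polyXn map_polyX.
have [e] := cubic_extreme_coefs alpha; rewrite -D_factor DE' => prodE.
have sigmaE : \sum_i alpha i = iota (- A).
  have /(congr1 (fun P : {poly L} => P`_1)) := prodE.
  rewrite !(coefD, coefZ, coefX, coefXn, coef1) /= !mulr0 !mulr1 !addr0 !add0r.
  by rewrite rmorphN => ->; rewrite opprK.
have alpha_neq0 i : alpha i != 0.
  have : \prod_i alpha i != 0.
    have /(congr1 (fun P : {poly L} => P`_3)) := prodE.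
    rewrite !(coefD, coefZ, coefX, coefXn, coef1) /= !mulr0 !mulr1 !add0r => CE.
    by rewrite -oppr_eq0 -CE fmorph_eq0.
  by move/prodf_neq0; apply.
have size_D : (size D <= 4)%N.
  apply/leq_sizeP => j j4; rewrite DE !(coefD, coefZ, coefX, coefXn, coef1).
  by move: j j4 => [|[|[|[|j]]]] //= _; rewrite !mulr0 !addr0.
have [p size_p rE] := r_proper; have [q size_q sE] := s_proper.
have [|a aE] := expansion_exponential_sum D_factor (p := p) alpha_inj alpha_neq0.
  by rewrite -ltnS (leq_trans size_p).
have [|b bE] := expansion_exponential_sum D_factor (p := q) alpha_inj alpha_neq0.
  by rewrite -ltnS (leq_trans size_q).
set D2 := D \Po (2%:R *: 'X).
have D_neg : D \Po (- 'X) = D \Po ((-1) *: 'X) by rewrite scaleN1r.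
set Dn := D \Po (- 'X).
have D2_factor := scaled_factorization 2%:R D_factor.
have := scaled_factorization (-1) D_factor; rewrite -D_neg -/Dn => Dn_factor.
have D2_neq0 := split_denominator_neq0 D2_factor.
have Dn_neq0 := split_denominator_neq0 Dn_factor.
(* [w k] is the sum of [a i * b j] over both orders of the two other indices. *)
pose w k := \sum_i \sum_j if [&& i != j, i != k & j != k] then a i * b j else 0.
have [d2 d2E] := exponential_sum_in_span D2_factor (fun i => a i * b i).
have [dn dnE] := exponential_sum_in_span Dn_factor w.
pose e2 (j : 'I_3) := expansion (('X^j)%:F / D2%:F).
pose en (j : 'I_3) := expansion (('X^j)%:F / Dn%:F).
pose eA := expansion (1 / (1 + A *: 'X)%:F).
pose g (i : 'I_(3 + 3)) :=
  match split i with inl j => e2 j | inr j => eA \odot en j end.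
pose c (i : 'I_(3 + 3)) := match split i with inl j => d2 j | inr j => dn j end.
have splitl j : split (lshift 3 j : 'I_(3 + 3)) = inl j := unsplitK (inl j).
have splitr j : split (rshift 3 j : 'I_(3 + 3)) = inr j := unsplitK (inr j).
have [|d dE] := @span_descent _ _ iota _ _ g (expansion r \odot expansion s) c.
  move=> n; rewrite map_binomial_product.
  rewrite (@eq_binomial_product _ _ (fun n => \sum_i a i * alpha i ^+ n) _
    (fun n => \sum_i b i * alpha i ^+ n)); first last.
  - by move=> k; rewrite /= sE bE.
  - by move=> k; rewrite /= rE aE.
  rewrite big_split_ord /=.
  under [X in _ = X + _]eq_bigr do rewrite /c /g splitl.
  under [X in _ = _ + X]eq_bigr do rewrite /c /g splitr map_binomial_product.
  rewrite -d2E -binomial_product_sumr.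
  rewrite [X in _ = _ + X](@eq_binomial_product _ _ (fun n => iota (- A) ^+ n) _
    (fun n => \sum_k w k * (iota (-1) * alpha k) ^+ n)); first last.
  - by move=> k; rewrite dnE.
  - by move=> k; rewrite /= /eA expansion_geometric rmorphXn.
  rewrite binomial_product_suml binomial_product_sumr.
  under eq_bigr do rewrite binomial_product_sumr.
  under eq_bigr do under eq_bigr do rewrite binomial_product_geometric.
  under [X in _ = _ + X]eq_bigr do
    rewrite binomial_product_geometric -sigmaE rmorphN1 mulN1r.
  by rewrite power_sum_pairs rmorph_nat.
exists (\sum_(j < 3) d (lshift 3 j) *: 'X^j), (\sum_(j < 3) d (rshift 3 j) *: 'X^j).
split; first exact: size_sumX.
split; first exact: size_sumX.
move=> n; rewrite dE big_split_ord /=; congr (_ + _).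
  by rewrite expansion_sumX //; apply: eq_bigr => j _; rewrite /g splitl.
rewrite (eq_binomial_product (frefl _) (fun k => expansion_sumX _ k Dn_neq0)).
rewrite binomial_product_sumr.
by apply: eq_bigr => j _; rewrite /g splitr.
Qed.
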